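(* For every integer $n\ge 3$, the maximum number of real spherical embeddings (embeddings in $S^2$) among Laman graphs with $n$ vertices is at least $$2^{(n-3)\bmod 3}\cdot 2\cdot 16^{\lfloor (n-3)/3\rfloor}.$$ This bound grows asymptotically (up to constant factors) as $(16^{1/3})^{n}$, where $16^{1/3}\approx 2.51984$.
   Context: All graphs are finite and simple. A Laman graph is a generically minimally rigid graph in $\mathbb{R}^2$; equivalently, a graph $G=(V,E)$ with $|E|=2|V|-3$ such that every subgraph $(V',E')$ with $|V'|\ge 2$ satisfies $|E'|\le 2|V'|-3$. (The same graphs are the minimally rigid graphs on $S^2$.) Let $S^2\subset\mathbb{R}^3$ be the unit sphere centered at the origin. For a graph $G=(V,E)$ and edge lengths $\boldsymbol{\lambda}=(\lambda_e)_{e\in E}\in\mathbb{R}_{+}^{|E|}$, a (real) spherical embedding of $(G,\boldsymbol{\lambda})$ is a map $\rho:V\to S^2$ with $\|\rho(a)-\rho(b)\|=\lambda_{ab}$ (Euclidean distance in $\mathbb{R}^3$) for every edge $ab\in E$; injectivity is not required. Spherical embeddings are counted modulo rotations of the sphere (elements of $SO(3)$); thus a generic spherical triangle has $2$ spherical embeddings. Let $r_{S^2}(G,\boldsymbol{\lambda})$ be the number of spherical embeddings of $(G,\boldsymbol{\lambda})$ modulo rotations, and let $r_{S^2}(G)$ be the maximum of $r_{S^2}(G,\boldsymbol{\lambda})$ over all $\boldsymbol{\lambda}\in\mathbb{R}_+^{|E|}$ for which it is finite. The maximum number of spherical embeddings among Laman graphs with $n$ vertices is the maximum of $r_{S^2}(G)$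 over all Laman graphs $G$ with $n$ vertices. The expression $(n-3)\bmod 3$ denotes the remainder in $\{0,1,2\}$. *)

(* Defs.v *)
From mathcomp Require Import all_boot all_order all_algebra.
From mathcomp Require Import all_classical all_reals all_analysis.

Set Implicit Arguments.
Unset Strict Implicit.
Unset Printing Implicit Defensive.

Import Order.TTheory GRing.Theory Num.Theory.

Local Open Scope classical_set_scope.
Local Open Scope ring_scope.

Section Graphs.
Variable V : finType.

(* A simple graph on the vertex set V is given by its set of edges, an edge
   being a 2-element set of vertices. *)
Definition simple_graph (E : {set {set V}}) : bool :=
  [forall e in E, #|e| == 2].

Definition subgraph (V' : {set V}) (E' E : {set {set V}}) : bool :=
  (E' \subset E) && [forall e in E', e \subset V'].

(* |E| = 2|V| - 3 is written additively because subtraction on nat is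
   truncated; the other subtraction is harmless since 2 <= |V'|. *)
Definition laman (E : {set {set V}}) : bool :=
  [&& simple_graph E,
      (#|E| + 3 == 2 * #|V|)%N &
      [forall V' : {set V}, forall E' : {set {set V}},
        subgraph V' E' E && (2 <= #|V'|)%N ==> (#|E'| <= 2 * #|V'| - 3)%N]].

End Graphs.

Section SphericalEmbeddings.
Variables (R : realType) (V : finType).
Implicit Types (E : {set {set V}}) (lambda : {set V} -> R).
Implicit Types rho : V -> 'rV[R]_3.

(* The norm that the library puts on matrices is the sup norm. *)
Definition euclidean_norm (x : 'rV[R]_3) : R :=
  Num.sqrt (\sum_(i < 3) x 0 i ^+ 2).

Definition unit_sphere : set 'rV[R]_3 := [set x | euclidean_norm x = 1].

Definition SO3 : set 'M[R]_3 := [set A | A *m A^T = 1%:M /\ \det A = 1].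

(* Only the values of lambda on the edges matter. *)
Definition spherical_embeddings E lambda : set (V -> 'rV[R]_3) :=
  [set rho | (forall v, unit_sphere (rho v)) /\
     forall a b, [set a; b]%SET \in E ->
       euclidean_norm (rho a - rho b) = lambda [set a; b]%SET].

Definition rotation_orbit rho : set (V -> 'rV[R]_3) :=
  [set (fun v => rho v *m A) | A in SO3].

Definition embeddings_mod_rotations E lambda : set (set (V -> 'rV[R]_3)) :=
  rotation_orbit @` spherical_embeddings E lambda.

Definition r_sphere_at E lambda : \bar R :=
  counting (embeddings_mod_rotations E lambda).

(* A supremum in \bar R, so that no existence proof for the maximum is part of
   the definition; a set of natural numbers has a supremum at least m, with m
   a natural number, if and only if one of its elements is at least m. *)
Definition r_sphere E : \bar R :=
  ereal_sup [set r_sphere_at E lambda | lambda in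
    [set lambda | (forall e, e \in E -> 0 < lambda e) /\
                  finite_set (embeddings_mod_rotations E lambda)]].

End SphericalEmbeddings.

(* Every graph with n vertices is isomorphic to one on 'I_n. *)
Definition max_spherical_embeddings (R : realType) (n : nat) : \bar R :=
  \big[maxe/-oo%E]_(E : {set {set 'I_n}} | laman E) r_sphere R E.

Definition sphere_bound (n : nat) : nat :=
  (2 ^ ((n - 3) %% 3) * 2 * 16 ^ ((n - 3) %/ 3))%N.

(* Main.v *)
Require Import Defs.
From mathcomp Require Import all_boot all_order all_algebra.
From mathcomp Require Import all_classical all_reals all_analysis.
From mathcomp Require Import finmap zify ring lra.

Import Order.TTheory GRing.Theory Num.Theory.

Local Open Scope classical_set_scope.
Local Open Scope ring_scope.

(** Give every edge the length [sqrt 2], so that adjacent vertices are mapped to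
    orthogonal unit vectors.  A triangle is then mapped to an orthonormal frame,
    and modulo rotations the base triangle has 2 embeddings.  Join a second
    triangle to the base triangle by three edges forming a prism: in the
    coordinates of the base frame its frame is an orthogonal 3x3 matrix with zero
    diagonal, hence a 3-cycle with signs, which leaves 2 * 2^3 = 16 choices.
    Gluing (n-3)/3 such triangles to the same base triangle, and joining the at
    most 2 remaining vertices to two base vertices (2 choices each), gives a Laman
    graph reaching the bound; the embeddings are finitely many because all
    coordinates in the base frame are 0, 1 or -1. *)

(** * The prism fan and its Laman counts *)

Section PrismFan.
Local Open Scope nat_scope.

(* For [i < j]: the base triangle is {0, 1, 2}, the [q]-th glued triangle is
   {3q, 3q+1, 3q+2} with 3q+r joined to r, and a leftover vertex
   (j / 3 = n / 3) is joined to 0 and 1. *)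
Definition fan_adj (n i j : nat) : bool :=
  if j %/ 3 < n %/ 3 then (i %/ 3 == j %/ 3) || (i == j %% 3) else i < 2.

Definition fan_pairs (n : nat) : {set 'I_n * 'I_n} :=
  [set p : 'I_n * 'I_n | (p.1 < p.2) && fan_adj n p.1 p.2].

Definition prism_fan (n : nat) : {set {set 'I_n}} :=
  [set [set p.1; p.2]%SET | p in fan_pairs n].

(** The cut-off [m] is separate from [n], so that the graph can be built up vertex by vertex while
    [n] still decides which vertices are leftovers. The predicate [x] selects an induced
    subgraph. *)
Definition fan_count (n m : nat) (x : nat -> bool) : nat :=
  \sum_(0 <= j < m) \sum_(0 <= i < j) [&& fan_adj n i j, x i & x j].

Lemma set2_ord_inj n (a b c d : 'I_n) :
  a < b -> c < d -> [set a; b]%SET = [set c; d]%SET -> (a, b) = (c, d).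
Proof.
move=> ab cd E.
have := set21 a b; have := set22 a b; rewrite E !inE.
move=> /orP[] /eqP Hb /orP[] /eqP Ha; subst; rewrite ?ltnn // in ab cd *.
by have := ltn_trans ab cd; rewrite ltnn.
Qed.

Lemma card_fan_pairs n (x : nat -> bool) :
  #|[set p in fan_pairs n | x p.1 && x p.2]| = fan_count n n x.
Proof.
rewrite -sum1_card /fan_count big_mkord.
rewrite (eq_bigl (fun p : 'I_n * 'I_n =>
   [&& p.1 < p.2, fan_adj n p.1 p.2, x p.1 & x p.2])); last first.
  by move=> p; rewrite !inE -andbA.
rewrite big_mkcond /=.
rewrite -(pair_bigA _ (fun i j : 'I_n =>
  if [&& i < j, fan_adj n i j, x i & x j] then 1 else 0)) /=.
rewrite exchange_big; apply: eq_bigr => j _.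
rewrite (big_nat_widen _ _ n) ?(ltnW (ltn_ord j)) // big_mkord [RHS]big_mkcond.
by apply: eq_bigr => i _; case: (i < j); case: fan_adj; case: (x i); case: (x j).
Qed.

Lemma card_prism_fan n : #|prism_fan n| = fan_count n n predT.
Proof.
rewrite -card_fan_pairs card_in_imset; last first.
  by move=> -[a b] [c d]; rewrite !inE /= => /andP[ab _] /andP[cd _]; apply: set2_ord_inj.
by apply: eq_card => p; rewrite !inE /= andbT.
Qed.

(** An earlier vertex below 3 lies in another block and can only match the residue [r]; the
    remaining ones exceed every residue and lie in earlier blocks. *)
Lemma fan_low_block n q r x : 0 < q -> q < n %/ 3 -> r < 3 ->
  \sum_(0 <= i < 3 * q) [&& fan_adj n i (3 * q + r), x i & x (3 * q + r)]
  = x r && x (3 * q + r) :> nat.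
Proof.
move=> q0 qn r3; rewrite (@big_cat_nat _ _ _ 3) //=; last lia.
rewrite [X in _ + X]big_nat_cond [X in _ + X]big1 ?addn0; last first.
  move=> i /andP[/andP[i3 iq] _]; rewrite /fan_adj ifT; last lia.
  by have -> : (i %/ 3 == (3 * q + r) %/ 3) || (i == (3 * q + r) %% 3) = false by lia.
have E i : i < 3 -> fan_adj n i (3 * q + r) = (i == r).
  by move=> i3; rewrite /fan_adj ifT; lia.
rewrite /index_iota /= !big_cons big_nil !E //.
by case: r r3 {E} => [|[|[|]]] //= _; rewrite ?addn0.
Qed.

(** The six new terms are the three prism edges to the base, then the three edges of the glued
    triangle. *)
Lemma fan_count_block n q x : 0 < q -> q < n %/ 3 ->
  fan_count n (3 * q.+1) x = fan_count n (3 * q) x +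
    ((x 0 && x (3 * q)) + (x 1 && x (3 * q).+1) + (x 2 && x (3 * q).+2) +
     (x (3 * q) && x (3 * q).+1) + (x (3 * q) && x (3 * q).+2) +
     (x (3 * q).+1 && x (3 * q).+2)).
Proof.
move=> q0 qn; rewrite /fan_count mulnSr addn3.
have low r := @fan_low_block n q r x q0 qn.
have E i j : 3 * q <= i < j -> j < (3 * q).+3 -> fan_adj n i j.
  by move=> ? ?; rewrite /fan_adj ifT; lia.
have := low 0 isT; have := low 1 isT; have := low 2 isT.
rewrite addn0 addn1 addn2 => low2 low1 low0.
rewrite !(big_nat_recr _ 0) //= low0 low1 low2 !E; lia.
Qed.

Lemma fan_count_base n x : 3 <= n ->
  fan_count n 3 x = (x 0 && x 1) + (x 0 && x 2) + (x 1 && x 2).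
Proof.
move=> n3; rewrite /fan_count /index_iota /= !big_cons !big_nil /=.
have E i j : i < 3 -> j < 3 -> fan_adj n i j.
  by move=> ? ?; rewrite /fan_adj ifT; lia.
by rewrite !E //=; lia.
Qed.

Lemma fan_count_extra n j x : 3 <= j -> n %/ 3 <= j %/ 3 ->
  fan_count n j.+1 x = fan_count n j x + ((x 0 && x j) + (x 1 && x j)).
Proof.
move=> j3 nj; rewrite /fan_count big_nat_recr //=; congr addn.
rewrite (@big_cat_nat _ _ _ 2) //=; last lia.
have E i : fan_adj n i j = (i < 2) by rewrite /fan_adj ifF //; lia.
rewrite [X in _ + X]big_nat_cond [X in _ + X]big1 ?addn0; last first.
  by move=> i /andP[/andP[i3 iq] _]; rewrite E; have -> : (i < 2) = false by lia.
by rewrite /index_iota /= !big_cons big_nil !E /= addn0.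
Qed.

(* [t], [m], [f] count the vertices of the base triangle, the other vertices, and
   the edges outside the base triangle in an induced subgraph: this is the Laman
   count in a form that is stable under adding a glued triangle. *)
Definition fan_bound (t m f : nat) : Prop :=
  [/\ f <= 2 * m, t <= 1 -> 0 < m -> f <= 2 * m - 1,
      t = 0 -> 0 < m -> f <= 2 * m - 2 & t = 0 -> 1 < m -> f <= 2 * m - 3].

(** The six bits leave 64 cases, each linear in [m] and [f]. *)
Lemma fan_bound_block (x0 x1 x2 y0 y1 y2 : bool) m f :
  fan_bound (x0 + x1 + x2) m f ->
  fan_bound (x0 + x1 + x2) (m + y0 + y1 + y2)
    (f + ((x0 && y0) + (x1 && y1) + (x2 && y2) +
          (y0 && y1) + (y0 && y2) + (y1 && y2))).
Proof.
by rewrite /fan_bound; case: x0 x1 x2 y0 y1 y2 => [] [] [] [] [] [] [] /=; split; lia.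
Qed.

Lemma fan_bound_extra (x0 x1 x2 y : bool) m f :
  fan_bound (x0 + x1 + x2) m f ->
  fan_bound (x0 + x1 + x2) (m + y) (f + ((x0 && y) + (x1 && y))).
Proof.
by rewrite /fan_bound; case: x0 x1 x2 y => [] [] [] [] [] /=; split; lia.
Qed.

(** Induction along the construction, with the base edges split off: whole triangles first, then the
    leftover vertices one at a time. *)
Lemma fan_count_bound n (x : nat -> bool) : 3 <= n ->
  let t := x 0 + x 1 + x 2 in
  exists f, fan_count n n x = (x 0 && x 1) + (x 0 && x 2) + (x 1 && x 2) + f /\
    fan_bound t (\sum_(3 <= i < n) x i) f.
Proof.
move=> n3 t.
have blocks q : 0 < q -> q <= n %/ 3 -> exists f,
    fan_count n (3 * q) x = (x 0 && x 1) + (x 0 && x 2) + (x 1 && x 2) + f /\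
    fan_bound t (\sum_(3 <= i < 3 * q) x i) f.
  elim: q => // -[_ _ _|q IH _ qn].
    by exists 0; rewrite muln1 fan_count_base // addn0 big_geq.
  have [//|//|f [fE fB]] := IH; first exact: ltnW.
  rewrite fan_count_block // fE; eexists; rewrite -addnA; split; first by [].
  rewrite (mulnSr 3 q.+1) addn3 3?(big_nat_recr _ 3) /=; try lia.
  exact: fan_bound_block.
have extra j : 3 * (n %/ 3) <= j -> j <= n -> exists f,
    fan_count n j x = (x 0 && x 1) + (x 0 && x 2) + (x 1 && x 2) + f /\
    fan_bound t (\sum_(3 <= i < j) x i) f.
  elim: j => [|j IH]; first lia.
  rewrite leq_eqVlt => /orP[/eqP<- _|nj jn]; first by apply: blocks; lia.
  have [||f [fE fB]] := IH; [lia|lia|].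
  rewrite fan_count_extra; [|lia|lia].
  rewrite fE; eexists; rewrite -addnA; split; first by [].
  rewrite (big_nat_recr _ 3); last lia.
  exact: fan_bound_extra.
by apply: extra; lia.
Qed.

(** For [t] = 0, 1, 2, 3 the chosen base vertices span 0, 0, 1, 3 edges; added to the matching
    clause of [fan_bound], this gives at most 2(t + m) - 3 in each case. *)
Lemma fan_count_sparse n (x : nat -> bool) : 3 <= n ->
  2 <= \sum_(i < n) x i -> fan_count n n x <= 2 * (\sum_(i < n) x i) - 3.
Proof.
move=> n3; have [f [-> [B1 B2 B3 B4]]] := @fan_count_bound n x n3.
have -> : \sum_(i < n) x i = x 0 + x 1 + x 2 + \sum_(3 <= i < n) x i.
  rewrite -(big_mkord predT (fun i => nat_of_bool (x i))) (@big_cat_nat _ _ _ 3) //=.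
  by congr addn; rewrite /index_iota /= !big_cons big_nil /=; lia.
move: (\sum_(3 <= i < n) x i) B1 B2 B3 B4 => m.
by move: (x 0) (x 1) (x 2) => [] [] []; rewrite /=; lia.
Qed.

(** Both sides start at 6 for the base triangle; a glued triangle brings 6 edges with 3 vertices, a
    leftover 2 edges with 1 vertex. *)
Lemma fan_count_all n : 3 <= n -> fan_count n n predT + 3 = 2 * n.
Proof.
move=> n3.
have blocks q : 0 < q -> q <= n %/ 3 -> fan_count n (3 * q) predT + 3 = 2 * (3 * q).
  elim: q => // -[_ _ _|q IH _ qn]; first by rewrite muln1 fan_count_base.
  by rewrite fan_count_block //=; have := IH isT (ltnW qn); lia.
have extra j : 3 * (n %/ 3) <= j -> j <= n -> fan_count n j predT + 3 = 2 * j.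
  elim: j => [|j IH]; first lia.
  rewrite leq_eqVlt => /orP[/eqP<- _|nj jn]; first by apply: blocks; lia.
  by rewrite fan_count_extra /=; [have := IH nj (ltnW jn); lia|lia|lia].
by apply: extra; lia.
Qed.

Lemma laman_prism_fan n : 3 <= n -> laman (prism_fan n).
Proof.
move=> n3; apply/and3P; split.
- apply/forall_inP => e /imsetP[[a b]]; rewrite inE /= => /andP[ab _] ->.
  by rewrite cards2 (_ : a != b) //; apply: contraTneq ab => ->; rewrite ltnn.
- by rewrite card_prism_fan fan_count_all // card_ord.
apply/forallP => V'; apply/forallP => E'; apply/implyP => /andP[/andP[sub inV']].
(* The indicator of [V'], extended by [false] to all naturals. *)
pose x i := oapp (mem V') false (insub i : option 'I_n).
have xE (v : 'I_n) : x v = (v \in V') by rewrite /x valK.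
have cardV : #|V'| = \sum_(i < n) x i.
  by rewrite -sum1_card big_mkcond; apply: eq_bigr => i _; rewrite xE; case: (i \in V').
rewrite cardV => V2; apply: leq_trans (fan_count_sparse n x n3 V2).
(* [E'] is contained in the image of the pairs with both ends in [V'], the edges of the induced
   subgraph. *)
rewrite -card_fan_pairs.
apply: leq_trans (leq_imset_card (fun p : 'I_n * 'I_n => [set p.1; p.2]%SET) _).
apply: subset_leq_card; apply/fintype.subsetP => e eE'.
have /imsetP[p pP eE] := fintype.subsetP sub e eE'.
apply/imsetP; exists p => //; rewrite inE pP /= !xE.
have /fintype.subsetP eV := forall_inP inV' e eE'.
by rewrite !eV // eE !inE eqxx ?orbT.
Qed.

Lemma prism_fan_edge n (a b : 'I_n) : a < b ->
  ([set a; b]%SET \in prism_fan n) = fan_adj n a b.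
Proof.
move=> ab; apply/imsetP/idP => [[[c d]]|adj]; last by exists (a, b); rewrite ?inE ?ab.
by rewrite inE /= => /andP[cd adj] /(set2_ord_inj _ _ _ _ _ ab cd)[-> ->].
Qed.

End PrismFan.

(** * Orthogonality and embeddings with all lengths sqrt 2 *)

Section OrthogonalEmbeddings.
Variable R : realType.
Implicit Types (x y : 'rV[R]_3) (A : 'M[R]_3).

Definition dotp x y : R := \sum_(i < 3) x 0 i * y 0 i.

Lemma big_ord3 (T : Type) (idx : T) (op : Monoid.law idx) (F : 'I_3 -> T) :
  \big[op/idx]_(i < 3) F i = op (op (F 0) (F 1)) (F 2%:R).
Proof.
rewrite !big_ord_recl big_ord0 Monoid.mulm1 Monoid.mulmA.
by congr (op (op (F _) (F _)) (F _)); apply/val_inj.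
Qed.

Lemma ord3_ind (P : 'I_3 -> Prop) : P 0 -> P 1 -> P 2%:R -> forall i, P i.
Proof.
move=> P0 P1 P2 [[|[|[|//]]] lti].
- by rewrite (_ : Ordinal lti = 0) //; apply: val_inj.
- by rewrite (_ : Ordinal lti = 1) //; apply: val_inj.
- by rewrite (_ : Ordinal lti = 2%:R) //; apply: val_inj.
Qed.

Lemma mulmx_tr_row m n (B : 'M[R]_(m, 3)) (C : 'M[R]_(n, 3)) i j :
  (B *m C^T) i j = dotp (row i B) (row j C).
Proof. by rewrite mxE; apply: eq_bigr => k _; rewrite !mxE. Qed.

Lemma dotpE x y : dotp x y = (x *m y^T) 0 0.
Proof. by rewrite mulmx_tr_row !row_id. Qed.

Lemma dotpC x y : dotp x y = dotp y x.
Proof. by apply: eq_bigr => i _; rewrite mulrC. Qed.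

Lemma dotp_orthogonal x y A : A *m A^T = 1%:M -> dotp (x *m A) (y *m A) = dotp x y.
Proof. by move=> AAT; rewrite !dotpE trmx_mul mulmxA -(mulmxA x) AAT mulmx1. Qed.

Lemma euclidean_normE x : euclidean_norm x = Num.sqrt (dotp x x).
Proof. by congr Num.sqrt; apply: eq_bigr => i _; rewrite expr2. Qed.

Lemma dotp_ge0 x : 0 <= dotp x x.
Proof. by apply: sumr_ge0 => i _; rewrite -expr2 sqr_ge0. Qed.

Lemma unit_sphereE x : unit_sphere x <-> dotp x x = 1.
Proof.
rewrite /unit_sphere /= euclidean_normE; split=> [|->]; last by rewrite sqrtr1.
by move=> x1; rewrite -(sqr_sqrtr (dotp_ge0 x)) x1 expr1n.
Qed.

(** The squared distance of two unit vectors is 2 - 2 [dotp x y]. *)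
Lemma dist_sqrt2 x y : dotp x x = 1 -> dotp y y = 1 ->
  euclidean_norm (x - y) = Num.sqrt 2 <-> dotp x y = 0.
Proof.
move=> xx yy.
have E : dotp (x - y) (x - y) = 2 - 2 * dotp x y.
  have -> : dotp (x - y) (x - y) = dotp x x + dotp y y - 2 * dotp x y.
    by rewrite /dotp !big_ord3 /= !mxE; ring.
  by rewrite xx yy.
have := dotp_ge0 (x - y); rewrite euclidean_normE E => ge0.
split=> [/eqP|->]; last by rewrite mulr0 subr0.
by rewrite eqr_sqrt // => /eqP; lra.
Qed.

Lemma embeddings_sqrt2P n (rho : 'I_n -> 'rV[R]_3) :
  spherical_embeddings (prism_fan n) (fun=> Num.sqrt 2) rho <->
  (forall v, dotp (rho v) (rho v) = 1) /\
  (forall a b : 'I_n, (a < b)%N -> fan_adj n a b -> dotp (rho a) (rho b) = 0).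
Proof.
split=> -[S O].
  split=> [v|a b ab adj]; first exact/unit_sphereE/S.
  apply/dist_sqrt2; try exact/unit_sphereE/S.
  by apply: O; rewrite prism_fan_edge.
split=> [v|a b]; first exact/unit_sphereE/S.
case: (ltngtP a b) => [ab|ba|/val_inj->].
- by rewrite prism_fan_edge // => adj; apply/dist_sqrt2; [exact: S..|exact: O].
- rewrite finset.setUC prism_fan_edge // => adj; apply/dist_sqrt2; try exact: S.
  by rewrite dotpC; apply: O.
(* The case [a = b]: a singleton is not an edge, since edges come from pairs [c < d]. *)
- move=> /imsetP[[c d]]; rewrite inE /= => /andP[cd _] E.
  have := set21 c d; have := set22 c d; rewrite -E !inE !orbb => /eqP dE /eqP cE.
  by move: cd; rewrite dE cE ltnn.
Qed.

Lemma SO3_mul A (B : 'M[R]_3) : SO3 A -> SO3 B -> SO3 (A *m B).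
Proof.
move=> [AA dA] [BB dB]; split; last by rewrite det_mulmx dA dB mulr1.
by rewrite trmx_mul mulmxA -(mulmxA A) BB mulmx1.
Qed.

Lemma SO3_tr A : SO3 A -> SO3 A^T.
Proof. by move=> [AA dA]; split; rewrite ?det_tr // trmxK; apply: mulmx1C. Qed.

Lemma rotation_orbit_rotate (V : finType) (rho : V -> 'rV[R]_3) A : SO3 A ->
  rotation_orbit rho = rotation_orbit (fun v => rho v *m A).
Proof.
move=> SA; apply/seteqP; split=> _ [B SB <-].
  exists (A^T *m B); first exact/SO3_mul/SB/SO3_tr.
  apply/funext => v; rewrite mulmxA -(mulmxA _ A); case: SA => -> _.
  by rewrite mulmx1.
exists (A *m B); first exact: SO3_mul.
by apply/funext => v; rewrite mulmxA.
Qed.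

(** With zero diagonal, two rows share only one column in which both may be nonzero, so
    orthogonality makes products of two entries vanish. Choosing which factor of [y * w] is zero
    forces all other entries up to sign: the matrix is one of the two 3-cycles with signs. The
    equation t^3 = t encodes that t is 0, 1 or -1. *)
Lemma orthogonal3_hollow A : A *m A^T = 1%:M -> (forall i, A i i = 0) ->
  forall i j, A i j ^+ 3 = A i j.
Proof.
move=> AAT A0.
have E i j : dotp (row i A) (row j A) = (i == j)%:R by rewrite -mulmx_tr_row AAT mxE.
have := E 0 0; have := E 1 1; have := E 2%:R 2%:R.
have := E 0 1; have := E 0 2%:R; have := E 1 2%:R.
rewrite /dotp !big_ord3 /= !mxE !A0 !(mulr0, mul0r, add0r, addr0) /=.
set x := A 0 1; set y := A 0 2%:R; set z := A 1 0; set w := A 1 2%:R.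
set u := A 2%:R 0; set v := A 2%:R 1.
move=> zu xv yw uv zw xy.
have sq1 (t : R) : t * t = 1 -> t ^+ 3 = t.
  by move=> t1; rewrite exprS expr2 t1 mulr1.
have sq0 (t : R) : t = 0 -> t ^+ 3 = t by move=> ->; rewrite expr0n.
have cases : [/\ x = 0, u = 0 & w = 0] /\ [/\ y * y = 1, z * z = 1 & v * v = 1] \/
             [/\ y = 0, v = 0 & z = 0] /\ [/\ x * x = 1, w * w = 1 & u * u = 1].
  have : y * w == 0 by apply/eqP.
  rewrite mulf_eq0 => /orP[] /eqP t0.
    right; have x1 : x * x = 1 by nra.
    have v0 : v = 0 by nra.
    have u1 : u * u = 1 by nra.
    have z0 : z = 0 by nra.
    by split; split=> //; nra.
  left; have z1 : z * z = 1 by nra.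
  have u0 : u = 0 by nra.
  have v1 : v * v = 1 by nra.
  have x0 : x = 0 by nra.
  by split; split=> //; nra.
have [X Y Z [W U V]] : [/\ x ^+ 3 = x, y ^+ 3 = y, z ^+ 3 = z &
    [/\ w ^+ 3 = w, u ^+ 3 = u & v ^+ 3 = v]].
  by case: cases => -[[? ? ?] [? ? ?]]; do 2?split; first [exact: sq0|exact: sq1].
by elim/ord3_ind => j; elim/ord3_ind: j => //; rewrite A0 expr0n.
Qed.

End OrthogonalEmbeddings.

(** * Explicit embeddings on the coordinate axes, pairwise inequivalent *)

Section FanEmbeddings.
Variable R : realType.

(* The bit [c q] selects one of the two 3-cycles for the [q]-th glued triangle. *)
Definition fan_axis (n : nat) (c : nat -> bool) (v : nat) : nat :=
  if (v < 3)%N then v else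
  if (v %/ 3 < n %/ 3)%N then ((v %% 3 + 1 + c (v %/ 3)) %% 3)%N else 2%N.

Definition fan_embedding (n : nat) (s c : nat -> bool) (v : 'I_n) : 'rV[R]_3 :=
  (-1) ^+ s v *: delta_mx 0 (inord (fan_axis n c v)).

Lemma fan_axis_lt n c v : (fan_axis n c v < 3)%N.
Proof. by rewrite /fan_axis; case: ifP => // _; case: ifP => //; rewrite ltn_mod. Qed.

(** Within a glued block the axes are a cyclic shift of the residues; the shift is by 1 or 2, so it
    never fixes the residue of the base neighbour. Leftovers use axis 2 and meet only axes 0 and
    1. *)
Lemma fan_axis_adj n c i j : (3 <= n)%N -> (i < j < n)%N -> fan_adj n i j ->
  fan_axis n c i != fan_axis n c j.
Proof.
move=> n3 ij; rewrite /fan_adj /fan_axis.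
case: (ltnP (j %/ 3) (n %/ 3)) => jn.
  move=> /orP[/eqP ijq|/eqP ijr]; last first.
    have -> : (i < 3)%N by lia.
    case: (ltnP j 3) => j3; first lia.
    by rewrite ijr; case: (c _); lia.
  rewrite -ijq in jn *; rewrite jn.
  case: (ltnP i 3) => i3; case: (ltnP j 3) => j3; lia.
move=> i2; have -> : (i < 3)%N by lia.
have -> : (j < 3)%N = false by lia.
lia.
Qed.

Lemma dotp_delta (a b : R) (i j : 'I_3) :
  dotp R (a *: delta_mx 0 i) (b *: delta_mx 0 j) = a * b * (i == j)%:R.
Proof.
rewrite /dotp (bigD1 i) //= big1 ?addr0 => [|k ki]; rewrite !mxE /=.
  by rewrite eqxx mulr1 mulrA.
by rewrite (negbTE ki) mulr0 mul0r.
Qed.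

Lemma inord_fan_axis_eq n c c' i j :
  (inord (fan_axis n c i) == inord (fan_axis n c' j) :> 'I_3) =
  (fan_axis n c i == fan_axis n c' j).
Proof. by rewrite -val_eqE /= !inordK ?fan_axis_lt. Qed.

Lemma fan_embeddingP n s c : (3 <= n)%N ->
  spherical_embeddings (prism_fan n) (fun=> Num.sqrt 2) (fan_embedding n s c).
Proof.
move=> n3; apply/embeddings_sqrt2P; split=> [v|a b ab adj]; rewrite dotp_delta.
  by rewrite eqxx mulr1 -expr2 sqrr_sign.
rewrite inord_fan_axis_eq (negbTE (fan_axis_adj _ c _ _ n3 _ adj)) ?mulr0 //.
by rewrite ab /=.
Qed.

Lemma scale_sign_delta_inj (b b' : bool) (i i' : 'I_3) :
  (-1) ^+ b *: delta_mx 0 i = (-1) ^+ b' *: delta_mx 0 i' :> 'rV[R]_3 ->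
  b = b' /\ i = i'.
Proof.
move=> /matrixP /(_ 0 i); rewrite !mxE /= eqxx mulr1.
case: eqP => [->|_]; last by move/eqP; rewrite mulr0 signr_eq0.
rewrite mulr1 => E; split=> //; apply: (@signr_inj R).
exact: E.
Qed.

(** The third row is orthogonal to the first two, so the matrix is diagonal, and the determinant
    makes its last entry 1. *)
Lemma SO3_fix2 (A : 'M[R]_3) : SO3 A ->
  row 0 A = delta_mx 0 0 -> row 1 A = delta_mx 0 1 -> A = 1%:M.
Proof.
move=> [AAT dA] r0 r1.
have E i j : dotp R (row i A) (row j A) = (i == j)%:R by rewrite -mulmx_tr_row AAT mxE.
have A0 j : A 0 j = (j == 0)%:R by move/rowP: r0 => /(_ j); rewrite !mxE.
have A1 j : A 1 j = (j == 1)%:R by move/rowP: r1 => /(_ j); rewrite !mxE.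
have := E 2%:R 0; rewrite /dotp big_ord3 /= !mxE !A0 /= mulr1 !mulr0 !addr0 => A20.
have := E 2%:R 1; rewrite /dotp big_ord3 /= !mxE !A1 /= mulr1 !mulr0 addr0 add0r => A21.
have A22 : A 2%:R 2%:R = 1.
  rewrite -dA det_trig; first by rewrite big_ord3 /= A0 A1 !mul1r.
  apply/is_trig_mxP; elim/ord3_ind => j; elim/ord3_ind: j => //= _;
  by rewrite ?A0 ?A1.
apply/matrixP; elim/ord3_ind => j; rewrite mxE ?A0 ?A1 1?[_ == j]eq_sym //.
by elim/ord3_ind: j; rewrite ?A20 ?A21 ?A22.
Qed.

(** Positive signs at vertices 0 and 1 pin the first two axes, so a rotation between two such
    embeddings is the identity. The sign of vertex 2 stays free and gives the two embeddings of the
    base triangle. *)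
Lemma fan_embedding_inj n s c s' c' : (3 <= n)%N ->
  s 0%N = false -> s 1%N = false -> s' 0%N = false -> s' 1%N = false ->
  rotation_orbit (fan_embedding n s c) = rotation_orbit (fan_embedding n s' c') ->
  forall v : 'I_n, s v = s' v /\ fan_axis n c v = fan_axis n c' v.
Proof.
move=> n3 s0 s1 s'0 s'1 E.
have : rotation_orbit (fan_embedding n s' c') (fan_embedding n s' c').
  exists 1%:M; first by split; rewrite ?trmx1 ?mulmx1 ?det1.
  by apply/funext => v; rewrite mulmx1.
rewrite -E => -[A SA /funeqP AE].
have fix_row (i : 'I_3) : (i < 2)%N -> row i A = delta_mx 0 i.
  move=> i2; have iltn : (i < n)%N by lia.
  have := AE (Ordinal iltn); rewrite /fan_embedding /fan_axis /= ltn_ord inord_val.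
  have [-> ->] : s i = false /\ s' i = false by case: i i2 {iltn} => [[|[|]]].
  by rewrite !scale1r -rowE.
have A1 := SO3_fix2 A SA (fix_row 0 isT) (fix_row 1 isT).
move=> v; have := AE v; rewrite A1 mulmx1 => /scale_sign_delta_inj[sE /eqP].
by rewrite inord_fan_axis_eq => /eqP.
Qed.

End FanEmbeddings.

(** * Finiteness of the set of embeddings and the lower bound *)

Section FanFinite.
Variable R : realType.

Lemma orthonormal_rows (w : 'I_3 -> 'rV[R]_3) :
  (forall i, dotp R (w i) (w i) = 1) ->
  (forall i j : 'I_3, (i < j)%N -> dotp R (w i) (w j) = 0) ->
  (\matrix_i w i) *m (\matrix_i w i)^T = 1%:M.
Proof.
move=> w1 w0; apply/matrixP => i j; rewrite mulmx_tr_row !rowK mxE.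
case: (ltngtP i j) => [ij|ji|/val_inj->]; last by rewrite eqxx w1.
- by rewrite w0 // -val_eqE /= ltn_eqF.
- by rewrite dotpC w0 // -val_eqE /= gtn_eqF.
Qed.

(** Coordinates are taken in the base frame [Q]. Base vertices become basis vectors, glued triangles
    hollow orthogonal matrices, and leftovers plus or minus the third basis vector. *)
Lemma fan_coordinates n (rho : 'I_n -> 'rV[R]_3) : (3 <= n)%N ->
  spherical_embeddings (prism_fan n) (fun=> Num.sqrt 2) rho ->
  exists2 A, SO3 A & forall v j, (rho v *m A) 0 j ^+ 3 = (rho v *m A) 0 j.
Proof.
move=> n3 /embeddings_sqrt2P[S O].
pose base : 'I_3 -> 'I_n := widen_ord n3.
pose Q : 'M[R]_3 := \matrix_i rho (base i).
have QQ : Q *m Q^T = 1%:M.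
  apply: orthonormal_rows => // i j ij; apply: O => //.
  by rewrite /fan_adj /base /= ifT; have := ltn_ord i; have := ltn_ord j; lia.
have dQ : \det Q ^+ 2 = 1 by rewrite expr2 -{2}det_tr -det_mulmx QQ det1.
have tE (v : 'I_n) j : (rho v *m Q^T) 0 j = dotp R (rho v) (rho (base j)).
  by rewrite mulmx_tr_row row_id rowK.
have coord v j : (rho v *m Q^T) 0 j ^+ 3 = (rho v *m Q^T) 0 j.
  have [vn|vn] := ltnP (v %/ 3) (n %/ 3).
    have blk (i : 'I_3) : (3 * (v %/ 3) + i < n)%N by have := ltn_ord i; lia.
    pose M : 'M[R]_3 := \matrix_i rho (Ordinal (blk i)).
    have MM : M *m M^T = 1%:M.
      apply: orthonormal_rows => // i k ik; apply: O; rewrite /= ?ltn_add2l //.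
      by rewrite /fan_adj ifT; have := ltn_ord i; have := ltn_ord k; lia.
    have vE : v = Ordinal (blk (inord (v %% 3))).
      by apply/val_inj; rewrite /= inordK ?ltn_mod //; lia.
    have [v3|v3] := ltnP v 3.
      have -> : (rho v *m Q^T) 0 j = (Ordinal v3 == j)%:R.
        have -> : rho v = row (Ordinal v3) Q.
          by rewrite rowK; congr rho; apply/val_inj.
        by rewrite -row_mul QQ row1 !mxE eqxx eq_sym.
      by case: eqP => _; rewrite ?expr1n ?expr0n.
    have -> : (rho v *m Q^T) 0 j = (M *m Q^T) (inord (v %% 3)) j.
      by rewrite tE mulmx_tr_row !rowK -vE.
    (* The diagonal of [M *m Q^T] vanishes because the [i]-th vertex of the block is joined to base
       vertex [i]. *)
    apply: orthogonal3_hollow.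
      by rewrite trmx_mul trmxK mulmxA -(mulmxA M) (mulmx1C QQ) mulmx1.
    move=> i; rewrite mulmx_tr_row !rowK dotpC; apply: O => /=.
      by have := ltn_ord i; lia.
    by rewrite /fan_adj ifT; have := ltn_ord i; lia.
  have t0 (i : 'I_3) : (i < 2)%N -> (rho v *m Q^T) 0 i = 0.
    move=> i2; rewrite tE dotpC; apply: O => /=; first by lia.
    by rewrite /fan_adj ifF; lia.
  have : dotp R (rho v *m Q^T) (rho v *m Q^T) = 1.
    by rewrite dotp_orthogonal ?S // trmxK (mulmx1C QQ).
  rewrite /dotp big_ord3 /= (t0 0) // (t0 1) // mulr0 !add0r -expr2 => t2.
  by elim/ord3_ind: j; [rewrite t0 // expr0n|rewrite t0 // expr0n|rewrite exprS t2 mulr1].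
(* The base frame may be left-handed. Scaling by [\det Q], which is 1 or -1, gives determinant
   ([\det Q])^4 = 1 in dimension 3 and keeps coordinates in {0, 1, -1}. *)
exists (\det Q *: Q^T).
  split.
    rewrite linearZ /= trmxK -scalemxAl -scalemxAr scalerA -expr2 dQ scale1r.
    exact: mulmx1C.
  by rewrite detZ det_tr -exprSr (exprM _ 2 2) dQ expr1n.
move=> v j; rewrite -scalemxAr mxE exprMn coord exprS dQ mulr1 //.
Qed.

(** Indexing the three roots by ['I_3] turns coordinate tables into elements of a finite type. *)
Lemma cube_fixed_val (t : R) : t ^+ 3 = t -> exists k : 'I_3, t = k%:R - 1.
Proof.
move=> t3; have /eqP : t * (t - 1) * (t + 1) = 0.
  by rewrite (_ : _ * _ = t ^+ 3 - t); [rewrite t3 subrr|ring].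
rewrite !mulf_eq0 subr_eq0 addr_eq0 => /orP[/orP[]|] /eqP->.
- by exists 1; rewrite subrr.
- by exists 2%:R; rewrite -[nat_of_ord _]/2%N; ring.
- by exists 0; rewrite sub0r.
Qed.

Lemma fan_embeddings_finite n : (3 <= n)%N ->
  finite_set (embeddings_mod_rotations (prism_fan n) (fun=> Num.sqrt 2 : R)).
Proof.
move=> n3.
pose G (g : {ffun 'I_n * 'I_3 -> 'I_3}) : 'I_n -> 'rV[R]_3 :=
  fun v => \row_j ((g (v, j))%:R - 1).
apply: (@sub_finite_set _ _ ((fun g => rotation_orbit (G g)) @` setT)); last first.
  exact/finite_image/finite_finset.
move=> _ [rho rhoE <-].
have [A SA cubeA] := fan_coordinates n rho n3 rhoE.
have [k kE] := choice (fun vj : 'I_n * 'I_3 => cube_fixed_val _ (cubeA vj.1 vj.2)).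
exists [ffun vj => k vj] => //; rewrite (rotation_orbit_rotate _ _ rho _ SA).
congr rotation_orbit; apply/funext => v; apply/rowP => j.
by rewrite mxE ffunE (kE (v, j)).
Qed.

Lemma counting_ge_card (U : choiceType) (T : finType) (X : set U) (f : T -> U) :
  finite_set X -> injective f -> (forall t, X (f t)) ->
  ((#|T|%:R)%:E <= (counting X : \bar R))%E.
Proof.
move=> finX injf fX; rewrite /counting asboolT // lee_fin ler_nat.
have <- : #|` [fset f t | t in T]%fset| = #|T| by rewrite card_imfset //= cardE.
apply: fsubset_leq_card; apply/fsubsetP => _ /imfsetP[t _ ->].
by rewrite in_fset_set //; apply/mem_set/fX.
Qed.

Lemma fan_embeddings_count n : (3 <= n)%N ->
  ((sphere_bound n)%:R%:E <= r_sphere_at (prism_fan n) (fun=> Num.sqrt 2 : R))%E.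
Proof.
move=> n3.
(* One sign bit for each vertex from 2 on, and one cycle bit for each glued triangle. With n = 3 +
   3k + r this makes 4k + r + 1 bits. *)
pose T : finType := ({ffun 'I_(n - 2) -> bool} * {ffun 'I_(n %/ 3 - 1) -> bool})%type.
have -> : sphere_bound n = #|T|.
  rewrite card_prod !card_ffun card_bool !card_ord /sphere_bound.
  rewrite -[16%N]/(2 ^ 4)%N -expnM -expnSr -!expnD; congr (2 ^ _)%N; lia.
(* The guard [1 < i] keeps vertices 0 and 1 positive, where [i - 2] would truncate to 0. *)
pose sgn (t : T) i := (1 < i)%N && oapp t.1 false (insub (i - 2)%N).
pose cyc (t : T) q := oapp t.2 false (insub (q - 1)%N).
apply: (counting_ge_card _ _ _ (fun t => rotation_orbit (fan_embedding R n (sgn t) (cyc t)))).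
- exact: fan_embeddings_finite.
- move=> t t' /fan_embedding_inj-/(_ n3 erefl erefl erefl erefl) E.
  case: t t' E => [s c] [s' c'] E; congr pair; apply/ffunP => i; have ilt := ltn_ord i.
    have vlt : (i + 2 < n)%N by lia.
    by have [] := E (Ordinal vlt); rewrite /sgn /= addnK !valK /= addn2.
  (* Cycle bit [i] is read off at the first vertex of block [i + 1], whose axis is 1 or 2. *)
  have vlt : (3 * (i + 1) < n)%N by lia.
  have [_] := E (Ordinal vlt); rewrite /fan_axis /= ifF; last lia.
  rewrite ifT; last lia.
  rewrite ifF; last lia.
  rewrite ifT; last lia.
  rewrite mulKn // /cyc addnK !valK /=.
  by case: (c i); case: (c' i) => //; lia.
- by move=> t; exists (fan_embedding R n (sgn t) (cyc t)) => //; exact: fan_embeddingP.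
Qed.

Lemma max_spherical_embeddings_ge n : (3 <= n)%N ->
  ((sphere_bound n)%:R%:E <= max_spherical_embeddings R n)%E.
Proof.
move=> n3; apply: le_trans (fan_embeddings_count n n3) _.
rewrite /max_spherical_embeddings.
apply: (@bigmax_sup _ _ _ _ (prism_fan n)); first exact: laman_prism_fan.
apply: ereal_sup_ubound; exists (fun=> Num.sqrt 2) => //; split=> [e _|].
  by rewrite sqrtr_gt0.
exact: fan_embeddings_finite.
Qed.

End FanFinite.

(** * Growth rate and the numerical value of the cube root of 16 *)

Section Asymptotics.
Variable R : realType.
Local Notation a := (16 `^ 3^-1 : R).

Lemma cuberoot16_exp3 : a ^+ 3 = 16.
Proof. by rewrite -powR_mulrn ?powR_ge0 // -powRrM mulVf // powRr1. Qed.

(** Cubing is increasing on nonnegative reals, so both bounds, 2.519835 and 2.519845, reduce to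
    comparing rational cubes with 16. *)
Lemma cuberoot16_approx :
  `|a - (2 + 5 / 10 + 1 / 10 ^+ 2 + 9 / 10 ^+ 3 + 8 / 10 ^+ 4 + 4 / 10 ^+ 5)|
    < 10 ^- 5 / 2 :> R.
Proof.
have a3 := cuberoot16_exp3; have a0 : 0 <= a by exact: powR_ge0.
have lo : 2 + 5 / 10 + 1 / 10 ^+ 2 + 9 / 10 ^+ 3 + 8 / 10 ^+ 4 + 35 / 10 ^+ 6 < a.
  by rewrite -(ltr_pXn2r (_ : 0 < 3)%N) ?nnegrE ?a3 //; lra.
have hi : a < 2 + 5 / 10 + 1 / 10 ^+ 2 + 9 / 10 ^+ 3 + 8 / 10 ^+ 4 + 45 / 10 ^+ 6.
  by rewrite -(ltr_pXn2r (_ : 0 < 3)%N) ?nnegrE ?a3 //; lra.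
by rewrite ltr_norml; apply/andP; split; lra.
Qed.

Lemma sphere_bound_Theta :
  (fun n : nat => (sphere_bound n)%:R : R^o) \is
    'Theta_\oo((fun n : nat => a ^+ n : R^o)).
Proof.
have a3 := cuberoot16_exp3.
have a0 : 0 <= a by exact: powR_ge0.
have a2 : 2 <= a by rewrite -(ler_pXn2r (_ : 0 < 3)%N) ?nnegrE ?a3 //; lra.
have a4 : a <= 4 by rewrite -(ler_pXn2r (_ : 0 < 3)%N) ?nnegrE ?a3 //; lra.
(* With n = 3 + 3k + r the quotient of the two functions is 2^r / (8 a^r). Since 2^r <= a^r <= 4 *
   2^r for r <= 2, it lies between 1/32 and 1/8, hence below 1. *)
rewrite qualifE; apply/asboolP; exists (32^-1, 1); first by rewrite /= ltr01 invr_gt0 ltr0n.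
near=> n.
have n3 : (3 <= n)%N by near: n; exists 3%N.
pose k := ((n - 3) %/ 3)%N; pose r := ((n - 3) %% 3)%N.
have r3 : (r < 3)%N by rewrite ltn_mod.
have -> : `|a ^+ n| = 16 * 16 ^+ k * a ^+ r.
  rewrite ger0_norm ?exprn_ge0 // (_ : n = 3 + 3 * k + r)%N; last lia.
  by rewrite exprD exprD exprM a3.
have -> : `|(sphere_bound n)%:R : R^o| = 2 * 16 ^+ k * 2 ^+ r.
  by rewrite ger0_norm // /sphere_bound -/k -/r !natrM !natrX; ring.
have k0 : 0 < 16 ^+ k :> R by rewrite exprn_gt0.
have rlo : 2 ^+ r <= a ^+ r by rewrite lerXn2r ?nnegrE.
have rhi : a ^+ r <= 4 * 2 ^+ r.
  by case: r r3 {rlo} => [|[|[|//]]] _; rewrite ?expr0 ?expr1 ?expr2; nra.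
have Klo : 16 ^+ k * 2 ^+ r <= 16 ^+ k * a ^+ r by rewrite ler_pM2l.
have Khi : 16 ^+ k * a ^+ r <= 16 ^+ k * (4 * 2 ^+ r) by rewrite ler_pM2l.
have K0 : 0 <= 16 ^+ k * 2 ^+ r :> R by rewrite mulr_ge0 ?exprn_ge0.
by rewrite /= -!mulrA; split; lra.
Unshelve. all: by end_near.
Qed.

End Asymptotics.

Theorem corollary2 (R : realType) :
  [/\ forall n : nat, (3 <= n)%N ->
        ((sphere_bound n)%:R%:E <= max_spherical_embeddings R n)%E,
      (fun n : nat => (sphere_bound n)%:R : R^o) \is
        'Theta_\oo((fun n : nat => (16 `^ 3^-1) ^+ n : R^o)) &
      `|16 `^ 3^-1 - (2 + 5 / 10 + 1 / 10 ^+ 2 + 9 / 10 ^+ 3 + 8 / 10 ^+ 4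
                        + 4 / 10 ^+ 5)| < 10 ^- 5 / 2 :> R].
Proof.
split.
- exact: max_spherical_embeddings_ge.
- exact: sphere_bound_Theta.
- exact: cuberoot16_approx.
Qed.
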